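(* Let $v^i=x^i+z^i$, $i\in\mathbb{N}$, where $\{x^i\}_{i\in\mathbb{N}}$ and $\{z^i\}_{i\in\mathbb{N}}$ are each i.i.d. zero mean random variables with finite variance (not necessarily Gaussian) and $\{z^i\}_{i\in\mathbb{N}}$ is independent of $\{x^i\}_{i\in\mathbb{N}}$. Let $R>0$ and $Q\ge0$ be real numbers, let $\mu_N=\frac1N\sum_{k=1}^N x^k$, and let $$J(\underline\gamma)=\limsup_{N\to\infty}\frac1N\mathbb{E}^{\underline\gamma}\Big[\sum_{i=1}^N R(u^i)^2+Q(u^i-x^i-\mu_N)^2\Big].$$ Then the policy given by $$\gamma_\infty^{k*}(v^k)=(R+Q)^{-1}Q\,\mathbb{E}(x^k\mid v^k),\qquad k\in\mathbb{N},$$ is globally optimal for $(\mathcal{P}_\infty)$, and it is obtained as the limit of $\gamma_N^{k*}(v^k)$ as $N\to\infty$, where $(\gamma_N^{1*},\dots,\gamma_N^{N*})$ is an optimal policy for $(\mathcal{P}_N)$.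
   Context: Static team: for each $i\in\mathbb{N}$ decision maker $i$ observes only the real random variable $v^i$ and applies the real action $u^i=\gamma^i(v^i)$, with $\gamma^i$ an arbitrary measurable function (the set of these is $\Gamma^i$). $\mathbb{E}^{\underline\gamma}$ means that $u^i=\gamma^i(v^i)$ is substituted for all $i$. $(\mathcal{P}_N)$: minimize $J_N(\underline\gamma_N)=\frac1N\mathbb{E}^{\underline\gamma_N}\big[\sum_{i=1}^N R(u^i)^2+Q(u^i-x^i-\mu_N)^2\big]$ over $\underline\gamma_N\in\prod_{i=1}^N\Gamma^i$; optimal means attaining the infimum. $(\mathcal{P}_\infty)$: minimize $J(\underline\gamma)$ over $\underline\gamma\in\prod_{i\in\mathbb{N}}\Gamma^i$; globally optimal means attaining the infimum. In the cost, the sum over $i$ runs over both terms. Limits of policies are understood $\mathbb{P}$-almost surely. *)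

(* Defs.v *)
From mathcomp Require Export all_boot all_order all_algebra.
From mathcomp Require Export all_classical all_reals all_analysis.
Set Implicit Arguments.
Unset Strict Implicit.
Unset Printing Implicit Defensive.
Import Order.TTheory GRing.Theory Num.Theory.
Import numFieldNormedType.Exports.

Local Open Scope classical_set_scope.
Local Open Scope ring_scope.
Local Open Scope ereal_scope.

Definition mutually_independent (d : measure_display) (T : measurableType d)
    (R : realType) (P : probability T R) (X : nat -> {RV P >-> R}) : Prop :=
  forall (s : seq nat) (A : nat -> set R), uniq s ->
    (forall i, measurable (A i)) ->
    P (\bigcap_(i in [set` s]) (X i @^-1` A i)) =
    \prod_(i <- s) P (X i @^-1` A i).

(* Laws are compared on measurable sets only: a measure is a function on all
   sets whose values on nonmeasurable ones carry no meaning. *)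
Definition identically_distributed (d : measure_display)
    (T : measurableType d) (R : realType) (P : probability T R)
    (X : nat -> {RV P >-> R}) : Prop :=
  forall (i j : nat) (A : set R), measurable A ->
    distribution P (X i) A = distribution P (X j) A.

Definition iid (d : measure_display) (T : measurableType d) (R : realType)
    (P : probability T R) (X : nat -> {RV P >-> R}) : Prop :=
  mutually_independent X /\ identically_distributed X.

Definition sigma_family (d : measure_display) (T : measurableType d)
    (R : realType) (P : probability T R) (X : nat -> {RV P >-> R}) :
    set (set T) :=
  <<s \bigcup_i preimage_set_system [set: T] (X i) measurable >>.

Definition independent_families (d : measure_display) (T : measurableType d)
    (R : realType) (P : probability T R) (X Y : nat -> {RV P >-> R}) : Prop :=
  forall A B : set T, sigma_family X A -> sigma_family Y B ->
    P (A `&` B) = P A * P B.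

(* [g] is a version of t |-> E(X | V = t), i.e. the random variable [g \o V] is
   a version of E(X | V); the events of sigma(V) are the V @^-1` B. *)
Definition is_cond_expectation (d : measure_display) (T : measurableType d)
    (R : realType) (P : probability T R) (X V : T -> R) (g : R -> R) : Prop :=
  [/\ measurable_fun [set: R] g,
      P.-integrable [set: T] (EFin \o (g \o V)) &
      forall B : set R, measurable B ->
        \int[P]_(w in V @^-1` B) (g (V w))%:E =
        \int[P]_(w in V @^-1` B) (X w)%:E].

(* Decision makers are numbered from 0; [I] is ['I_N] for the N-member team and
   [nat] for the infinite one. *)
Definition policies (R : realType) (I : Type) : set (I -> R -> R) :=
  [set gam | forall i, measurable_fun [set: R] (gam i)].

Definition mean_state (d : measure_display) (T : measurableType d)
    (R : realType) (P : probability T R) (x : nat -> {RV P >-> R})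
    (N : nat) (w : T) : R :=
  (N%:R^-1 * \sum_(k < N) x k w)%R.

Definition cost_N (d : measure_display) (T : measurableType d)
    (R : realType) (P : probability T R) (x v : nat -> {RV P >-> R}) (r q : R)
    (N : nat) (gam : 'I_N -> R -> R) : \bar R :=
  (N%:R^-1)%:E *
  'E_P[fun w => (\sum_(i < N) (r * gam i (v i w) ^+ 2
         + q * (gam i (v i w) - x i w - mean_state x N w) ^+ 2))%R].

Definition cost_infty (d : measure_display) (T : measurableType d)
    (R : realType) (P : probability T R) (x v : nat -> {RV P >-> R}) (r q : R)
    (gam : nat -> R -> R) : \bar R :=
  limn_esup (fun N => cost_N x v r q (fun i : 'I_N => gam i)).

Definition optimal_N (d : measure_display) (T : measurableType d)
    (R : realType) (P : probability T R) (x v : nat -> {RV P >-> R}) (r q : R)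
    (N : nat) (gam : 'I_N -> R -> R) : Prop :=
  policies gam /\
  cost_N x v r q gam =
    ereal_inf [set cost_N x v r q gam' | gam' in @policies R 'I_N].

Definition globally_optimal (d : measure_display) (T : measurableType d)
    (R : realType) (P : probability T R) (x v : nat -> {RV P >-> R}) (r q : R)
    (gam : nat -> R -> R) : Prop :=
  policies gam /\
  cost_infty x v r q gam =
    ereal_inf [set cost_infty x v r q gam' | gam' in @policies R nat].

(* The component of agent [k] along the teams of sizes k+1, k+2, ...: the
   policies for N <= k have no such component. *)
Definition agent_policies (R : realType) (k : nat)
    (gam : forall N : nat, 'I_N -> R -> R) (n : nat) : R -> R :=
  gam (k.+1 + n)%N (lshift n (@ord_max k)).

(* Main.v *)
Require Import Defs.
Import Order.TTheory GRing.Theory Num.Theory.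
Import numFieldNormedType.Exports.
From mathcomp Require Import measurable_realfun ring.

(** The cost contains no product of actions of different agents, so the team
problem splits into one quadratic problem per agent: agent [i] chooses [phi] to
minimise E[r phi(V)^2 + q (phi(V) - Y)^2] with V = v_i and Y = x_i + mu_N.
Completing the square and conditioning on V turns this cost into
(r + q) E[(phi(V) - c E(Y | V))^2] plus a constant, where c = q / (r + q)
([agent_cost], by the Pythagorean identity [cond_expectation_pythagoras]).  The
optimal action is therefore c E(Y | V), and it is unique almost surely.

The state x_k of another agent is centered and independent of v_i, hence
E(Y | v_i) = (1 + 1/N) E(x_i | v_i) ([cond_expectation_target]).  The optimal
policy of the team of size N is thus c (1 + 1/N) E(x_i | v_i), which converges
to c E(x_i | v_i); a countable union of null sets handles all N at once.

For the infinite team, the limit policy used in the team of size N differs from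
the optimal one by the gain c/N.  Its excess cost is at most
(r + q) (c/N)^2 E[x_0^2], since conditioning contracts the L2 norm and the
states have the same law.  This excess vanishes as N grows while the optimal
cost of size N is a lower bound for every policy, so no policy has a smaller
limit superior ([limit_policy_near_optimal]).

Conditional expectations given V exist by the Radon-Nikodym theorem applied on
the real line to the image under V of the charge with density Y.  Orthogonality
of Y - E(Y | V) to all functions of V is obtained from indicators by
approximation with simple functions ([integral_mul_comp_eq0]); the same
statement, with the roles exchanged, yields the product formula for a variable
independent of an event ([integral_indep_event]). *)

Local Open Scope classical_set_scope.
Local Open Scope ring_scope.

(** * Limits superior and square integrable functions *)

Section preliminaries.
Set Implicit Arguments.
Unset Strict Implicit.
Context (d : measure_display) (T : measurableType d) (R : realType).
Variable (P : probability T R).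
Local Open Scope ereal_scope.

Lemma measurable_preimage (f : T -> R) (B : set R) :
  measurable_fun setT f -> measurable B -> measurable (f @^-1` B).
Proof. by move=> mf mB; rewrite -[X in measurable X]setTI; exact: mf. Qed.

(** The slack [e] is fixed before the index threshold, so it passes to the limit
superior and can then be sent to 0. *)
Lemma le_limn_esup_near (a b : (\bar R)^nat) :
  (forall e : R, (0 < e)%R -> \forall n \near \oo, a n <= b n + e%:E) ->
  limn_esup a <= limn_esup b.
Proof.
move=> ab; rewrite /limn_esup [leRHS]limf_esupE.
apply: le_ereal_inf_tmp => _ [V FV <-].
apply/lee_addgt0Pr => e e0.
pose W := V `&` [set n | a n <= b n + e%:E].
have FW : \oo W by apply: filterI => //; exact: ab.
apply: (@le_trans _ _ (ereal_sup (a @` W))).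
  by apply: ereal_inf_lbound; exists W.
apply: ge_ereal_sup => _ [n [Vn /= abn] <-]; apply: (le_trans abn).
by rewrite leeD2r//; apply: ereal_sup_ubound; exists n.
Qed.

Lemma Lfun2P (f : T -> R) : f \in Lfun P 2%:E <->
  measurable_fun setT f /\ \int[P]_w (f w ^+ 2)%:E < +oo.
Proof.
split=> [fL|[mf f2]].
  split; first by move: fL => /sub_Lfun_mfun; rewrite inE.
  exact: (integrable_lty measurableT (Lfun2_integrable_sqr fL)).
rewrite inE; apply/andP; split; rewrite inE//= /finite_norm unlock /Lnorm.
rewrite poweR_lty//.
by under eq_integral => w _ do
  rewrite /= powR_mulrn// -normrX ger0_norm ?sqr_ge0//.
Qed.

Lemma Lfun2_mulr (f g : T -> R) : f \in Lfun P 2%:E -> g \in Lfun P 2%:E ->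
  P.-integrable setT (fun w => (f w * g w)%:E).
Proof. by move=> fL gL; apply/Lfun1_integrable/Lfun2_mul_Lfun1. Qed.

Lemma Lfun2D (f g : T -> R) : f \in Lfun P 2%:E -> g \in Lfun P 2%:E ->
  (fun w => f w + g w)%R \in Lfun P 2%:E.
Proof. by move=> fL gL; apply: (Lfun_addr_closed P (lee1n 2)).2. Qed.

Lemma Lfun2Z (a : R) (f : T -> R) : f \in Lfun P 2%:E ->
  (fun w => a * f w)%R \in Lfun P 2%:E.
Proof.
move=> fL; have := Lfun_scale a (ler1n R 2) fL.
rewrite (_ : _ \o* _ = fun w => a * f w)%R//.
by apply/funext => w /=; rewrite mulrC.
Qed.

Lemma Lfun2B (f g : T -> R) : f \in Lfun P 2%:E -> g \in Lfun P 2%:E ->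
  (fun w => f w - g w)%R \in Lfun P 2%:E.
Proof.
move=> fL gL; rewrite (_ : (fun _ => _) = (fun w => f w + (-1) * g w)%R).
  exact/Lfun2D/Lfun2Z.
by apply/funext => w; rewrite mulN1r.
Qed.

Lemma Lfun2_integrable (f : T -> R) : f \in Lfun P 2%:E ->
  P.-integrable setT (EFin \o f).
Proof.
move=> fL; apply/Lfun1_integrable; apply: Lfun_subset12 fL.
exact: fin_num_measure.
Qed.

Lemma Lfun2_integral_sqr_fin_num (f : T -> R) : f \in Lfun P 2%:E ->
  \int[P]_w (f w ^+ 2)%:E \is a fin_num.
Proof.
by move=> fL; apply: integrable_fin_num => //; exact: Lfun2_integrable_sqr.
Qed.

Lemma Lfun2_sum (I : Type) (s : seq I) (F : I -> T -> R) :
  (forall i, F i \in Lfun P 2%:E) ->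
  (fun w => \sum_(i <- s) F i w)%R \in Lfun P 2%:E.
Proof.
move=> FL; elim: s => [|i s ih].
  by under eq_fun do rewrite big_nil; exact: Lfun_cst.
by under eq_fun do rewrite big_cons; exact: Lfun2D.
Qed.

(** For a centered variable the variance is the second moment, so a finite
variance is square integrability. *)
Lemma centered_Lfun2 (X : {RV P >-> R}) :
  'E_P[X] = 0 -> 'V_P[X] < +oo -> (X : T -> R) \in Lfun P 2%:E.
Proof.
move=> X0 VX; apply/Lfun2P; split=> //.
move: VX; rewrite /variance unlock X0 /= unlock.
rewrite (_ : ((X \- cst 0) * (X \- cst 0))%R = (fun w => X w ^+ 2)%R)//.
by apply/funext => w; rewrite fctM /= subr0 expr2.
Qed.

(** A second moment is an integral against the law of the variable. *)
Lemma identically_distributed_sqr (X : nat -> {RV P >-> R}) i j :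
  identically_distributed X ->
  \int[P]_w (X i w ^+ 2)%:E = \int[P]_w (X j w ^+ 2)%:E.
Proof.
move=> Xd; pose f (t : R) := (t ^+ 2)%:E.
have mf : measurable_fun setT f by apply/measurable_EFinP/measurable_funX.
have f0 t : 0 <= f t by rewrite lee_fin sqr_ge0.
rewrite -(ge0_integral_distribution (X i) mf f0).
rewrite -(ge0_integral_distribution (X j) mf f0).
by apply: eq_measure_integral => A mA _; exact: Xd.
Qed.

End preliminaries.

(** * Conditional expectation *)

Section conditioning.
Set Implicit Arguments.
Unset Strict Implicit.
Context (d : measure_display) (T : measurableType d) (R : realType).
Variable (P : probability T R).
Local Open Scope ereal_scope.

Import HBSimple HBNNSimple.

(** A simple function of [V] is a finite combination of indicators of events of
sigma(V), on each of which [D] integrates to 0. *)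
Lemma integral_mul_sfun_eq0 (D : T -> R) (V : T -> R) (h : {sfun R >-> R}) :
  measurable_fun setT V -> P.-integrable setT (EFin \o D) ->
  (forall B, measurable B -> \int[P]_(w in V @^-1` B) (D w)%:E = 0) ->
  \int[P]_w (h (V w) * D w)%:E = 0.
Proof.
move=> mV iD D0.
pose Ay y := V @^-1` (h @^-1` [set y]).
have mA y : measurable (Ay y) by exact: measurable_preimage.
have iA y : P.-integrable setT (fun w => (\1_(Ay y) w)%:E * (D w)%:E).
  apply: (le_integrable measurableT _ _ iD).
    apply: emeasurable_funM; last exact: measurable_int iD.
    exact/measurable_EFinP.
  move=> w _; rewrite -EFinM lee_fin normrM ler_piMl//.
  by rewrite indicE; case: (_ \in _); rewrite ?normr1 ?normr0.
under eq_integral => w _.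
  rewrite fimfunE fsbig_finite//= mulr_suml -sumEFin.
  under eq_bigr => y _ do rewrite -mulrA 2!EFinM.
  over.
rewrite integral_sum//; last by move=> y; exact/integrableZl/iA.
apply: big1 => y _; rewrite integralZl//; last exact: iA.
have <- : \int[P]_(w in Ay y) (D w)%:E =
    \int[P]_w ((\1_(Ay y) w)%:E * (D w)%:E).
  rewrite integral_mkcond; apply: eq_integral => w _.
  by rewrite patchE indicE; case: ifPn => _; rewrite ?mul1e ?mul0e.
by rewrite D0// mule0.
Qed.

(** Dominated convergence extends orthogonality from simple functions to every
[phi] that keeps the product integrable.  Monotone approximation only dominates
nonnegative functions, hence the splitting of [phi] into positive and negative
parts.  The integrability condition bears on the product, rather than square
integrability on the factors, because [phi] will be a truncation used while [D]
is only known to be integrable. *)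
Lemma integral_mul_comp_eq0 (D : T -> R) (V : T -> R) (phi : R -> R) :
  measurable_fun setT V -> P.-integrable setT (EFin \o D) ->
  (forall B, measurable B -> \int[P]_(w in V @^-1` B) (D w)%:E = 0) ->
  measurable_fun setT phi ->
  P.-integrable setT (fun w => (phi (V w) * D w)%:E) ->
  \int[P]_w (phi (V w) * D w)%:E = 0.
Proof.
move=> mV iD D0 mphi iphiD.
have mD : measurable_fun setT D.
  by apply/measurable_EFinP; exact: measurable_int iD.
have pos (f : R -> R) : measurable_fun setT f -> (forall t, 0 <= f t)%R ->
    (forall t, f t <= `|phi t|)%R ->
    P.-integrable setT (fun w => (f (V w) * D w)%:E) /\
    \int[P]_w (f (V w) * D w)%:E = 0.
  move=> mf f0 fphi.
  have ifD : P.-integrable setT (fun w => (f (V w) * D w)%:E).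
    apply: (le_integrable measurableT _ _ iphiD).
      by apply/measurable_EFinP/measurable_funM => //; exact: measurableT_comp.
    move=> w _; rewrite lee_fin !normrM ler_wpM2r//.
    by rewrite (ger0_norm (f0 _)).
  split=> //.
  have mEf : measurable_fun setT (EFin \o f) by exact/measurable_EFinP.
  pose h := nnsfun_approx measurableT mEf.
  have h_le n t : (h n t <= f t)%R.
    rewrite -lee_fin /h nnsfun_approxE.
    exact: (le_approx n (fun t _ => f0 t : (0 <= (EFin \o f) t)%E)).
  have mh n : measurable_fun setT (fun w => (h n (V w) * D w)%:E).
    apply/measurable_EFinP/measurable_funM => //.
    exact: measurableT_comp.
  have h_cvg : {ae P, forall w, setT w ->
      (h n (V w) * D w)%:E @[n --> \oo] --> (f (V w) * D w)%:E}.
    apply/nearW => w _; under eq_fun do rewrite EFinM.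
    rewrite EFinM; apply: cvgeZr => //.
    exact: (cvg_nnsfun_approx measurableT mEf (fun t _ => f0 t)).
  have h_bound : {ae P, forall w n, setT w ->
      `|(h n (V w) * D w)%:E| <= `|(f (V w) * D w)%:E|}.
    apply/nearW => w n _; rewrite lee_fin !normrM ler_wpM2r//.
    by rewrite !ger0_norm.
  have [_ _ hf] := dominated_convergence measurableT mh
    (measurable_int _ ifD) h_cvg (integrable_abse ifD) h_bound.
  move: hf; rewrite (_ : (fun _ => _) = cst 0).
    by move=> /(cvg_unique _ (cvg_cst _)) <-.
  by apply/funext => n; exact: integral_mul_sfun_eq0.
have mp : measurable_fun setT (phi ^\+)%R by exact: measurable_funrpos.
have mn : measurable_fun setT (phi ^\-)%R by exact: measurable_funrneg.
have absE t : (phi^\+ t + phi^\- t = `|phi t|)%R.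
  by have := congr1 (fun f : R -> R => f t) (funrposDneg phi).
have subE t : (phi^\+ t - phi^\- t = phi t)%R.
  by have := congr1 (fun f : R -> R => f t) (funrposBneg phi).
have [ip p0] : P.-integrable setT (fun w => (phi^\+ (V w) * D w)%:E) /\
    \int[P]_w (phi^\+ (V w) * D w)%:E = 0.
  by apply: pos => // t; rewrite -absE lerDl.
have [i_n n0] : P.-integrable setT (fun w => (phi^\- (V w) * D w)%:E) /\
    \int[P]_w (phi^\- (V w) * D w)%:E = 0.
  by apply: pos => // t; rewrite -absE lerDr.
rewrite (eq_integral
  (fun w => (phi^\+ (V w) * D w)%:E - (phi^\- (V w) * D w)%:E)).
  by rewrite integralB_EFin// p0 n0 sube0.
by move=> w _; rewrite -EFinB -mulrBl subE.
Qed.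

Section given.
Variables (V : T -> R) (Y : T -> R) (g : R -> R).
Hypothesis mV : measurable_fun setT V.
Hypothesis YL : Y \in Lfun P 2%:E.
Hypothesis gE : is_cond_expectation P Y V g.

Lemma cond_expectation_residual :
  P.-integrable setT (EFin \o (fun w => Y w - g (V w))%R) /\
  forall B, measurable B -> \int[P]_(w in V @^-1` B) (Y w - g (V w))%:E = 0.
Proof.
have iY := Lfun2_integrable YL; case: gE => mg ig gB.
split.
  rewrite (_ : _ \o _ = (EFin \o Y) \- (EFin \o (g \o V))).
    exact: integrableB.
  by apply/funext => w /=; rewrite EFinB.
move=> B mB; have mVB := measurable_preimage mV mB.
under eq_integral do rewrite EFinB.
rewrite integralB_EFin//; try exact: (integrableS measurableT).
rewrite gB// subee// integrable_fin_num//; exact: (integrableS measurableT).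
Qed.

Lemma cond_expectation_orthogonal (phi : R -> R) : measurable_fun setT phi ->
  P.-integrable setT (fun w => (phi (V w) * (Y w - g (V w)))%:E) ->
  \int[P]_w (phi (V w) * (Y w - g (V w)))%:E = 0.
Proof.
move=> mphi iphi; have [iD D0] := cond_expectation_residual.
exact: integral_mul_comp_eq0.
Qed.

(** Conditioning contracts the L2 norm.  Since g(V) is not yet known to be
square integrable, it is replaced by its truncation t at level n, for which
t g(V) = t^2.  Then Y^2 >= 2 t Y - t^2 = 2 t (Y - g(V)) + t^2, and the first
term integrates to 0 by orthogonality; monotone convergence removes the
truncation. *)
Lemma cond_expectation_sqr_le :
  \int[P]_w (g (V w) ^+ 2)%:E <= \int[P]_w (Y w ^+ 2)%:E.
Proof.
have [mg ig _] := gE; have [iD _] := cond_expectation_residual.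
pose An (n : nat) : set R := [set t | `|g t| <= n%:R]%R.
pose gn n (t : R) := (g t * \1_(An n) t)%R.
have mA n : measurable (An n).
  rewrite (_ : An n = (Num.norm \o g) @^-1` `]-oo, n%:R]%classic).
    by apply: measurable_preimage => //; exact: measurableT_comp.
  by apply/seteqP; split => t /=; rewrite in_itv.
have mgn n : measurable_fun setT (gn n) by apply: measurable_funM.
have gn_le n t : (`|gn n t| <= n%:R)%R.
  rewrite /gn indicE; case: (boolP (t \in An n)) => [|_].
    by rewrite inE mulr1.
  by rewrite mulr0 normr0.
have gn_idem n t : (gn n t * g t = gn n t ^+ 2)%R.
  by rewrite /gn indicE; case: (_ \in _) => /=; ring.
have ign n : P.-integrable setT (fun w => (gn n (V w) * (Y w - g (V w)))%:E).
  apply: (le_integrable measurableT _ _ (integrableZl measurableT n%:R iD)).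
    apply/measurable_EFinP/measurable_funM; first exact: measurableT_comp.
    by apply/measurable_EFinP; exact: measurable_int iD.
  move=> w _; rewrite -EFinM lee_fin !normrM ler_wpM2r//.
  by rewrite -normrM (le_trans (gn_le _ _))// ler_norm.
have ign2 n : P.-integrable setT (EFin \o (fun w => gn n (V w) ^+ 2)%R).
  apply: Lfun2_integrable_sqr; apply/Lfun2P; split.
    exact: measurableT_comp.
  apply: (@le_lt_trans _ _ (\int[P]_w (n%:R ^+ 2)%:E)).
    apply: ge0_le_integral => //.
    - by move=> w _; rewrite lee_fin sqr_ge0.
    - by apply/measurable_EFinP/measurable_funX; exact: measurableT_comp.
    - move=> w _; rewrite lee_fin -[leLHS]real_normK ?num_real//.
      by rewrite lerXn2r ?nnegrE.
  by rewrite integral_cst//= probability_setT mule1 ltry.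
have ign_2 n :
    P.-integrable setT (fun w => 2%:E * (gn n (V w) * (Y w - g (V w)))%:E).
  exact: (integrableZl measurableT 2 (ign n)).
have gn2 n : \int[P]_w (gn n (V w) ^+ 2)%:E <= \int[P]_w (Y w ^+ 2)%:E.
  have -> : \int[P]_w (gn n (V w) ^+ 2)%:E =
      \int[P]_w (2%:E * (gn n (V w) * (Y w - g (V w)))%:E +
                 (gn n (V w) ^+ 2)%:E).
    rewrite integralD//; last exact: ign2.
    by rewrite integralZl// cond_expectation_orthogonal// mule0 add0e.
  apply: le_integral => //.
  - exact: (integrableD measurableT (ign_2 n) (ign2 n)).
  - exact: Lfun2_integrable_sqr.
  - move=> w _; rewrite -EFinM -EFinD lee_fin mulrBr gn_idem -subr_ge0.
    rewrite [leRHS](_ : _ = (Y w - gn n (V w)) ^+ 2)%R; first exact: sqr_ge0.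
    by ring.
have gn_cvg w : (gn n (V w) ^+ 2)%:E @[n --> \oo] --> (g (V w) ^+ 2)%:E.
  apply: cvg_near_cst; near=> n.
  rewrite /gn indicE mem_set ?mulr1// /An /=.
  near: n; exact: nbhs_infty_ger.
have <- : \int[P]_w limn (fun n => (gn n (V w) ^+ 2)%:E) =
    \int[P]_w (g (V w) ^+ 2)%:E.
  by apply: eq_integral => w _; exact/cvg_lim/gn_cvg.
have nd w : nondecreasing_seq (fun n => (gn n (V w) ^+ 2)%:E).
  move=> m n mn; rewrite lee_fin /gn !indicE.
  case: (boolP (V w \in An m)) => [|_]; last by rewrite mulr0 expr0n sqr_ge0.
  rewrite !inE /An/= => h; rewrite mem_set//=.
  by rewrite (le_trans h)// ler_nat.
have m2 n : measurable_fun setT (fun w => (gn n (V w) ^+ 2)%:E).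
  exact: measurable_int (ign2 n).
rewrite monotone_convergence//; last by move=> n w _; rewrite lee_fin sqr_ge0.
apply: lime_le; last exact: nearW.
apply: ereal_nondecreasing_is_cvgn => m n mn; apply: ge0_le_integral => //.
- by move=> w _; rewrite lee_fin sqr_ge0.
- by move=> w _; exact: nd.
Unshelve. all: by end_near. Qed.

Lemma cond_expectation_Lfun2 : g \o V \in Lfun P 2%:E.
Proof.
have [mg _ _] := gE; apply/Lfun2P; split; first exact: measurableT_comp.
apply: (le_lt_trans cond_expectation_sqr_le).
by have /Lfun2P[] := YL.
Qed.

(** [phi] is an arbitrary measurable function: when phi(V) is not square
integrable both sides are infinite, because phi(V) - g(V) is the sum of
phi(V) - Y and of the square integrable Y - g(V). *)
Lemma cond_expectation_pythagoras (phi : R -> R) : measurable_fun setT phi ->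
  \int[P]_w ((phi (V w) - Y w) ^+ 2)%:E =
  \int[P]_w ((phi (V w) - g (V w)) ^+ 2)%:E +
  \int[P]_w ((g (V w) - Y w) ^+ 2)%:E.
Proof.
move=> mphi; have [mg _ _] := gE; have gL := cond_expectation_Lfun2.
pose a w := (phi (V w) - g (V w))%R; pose b w := (g (V w) - Y w)%R.
have bL : b \in Lfun P 2%:E by exact: Lfun2B.
have maV : measurable_fun setT a.
  by apply: measurable_funB; exact: measurableT_comp.
have [aoo|] := ltP (\int[P]_w (a w ^+ 2)%:E) (+oo); last first.
  rewrite leye_eq => /eqP aoo; rewrite [in RHS]aoo addye; last first.
    rewrite gt_eqF// (lt_le_trans ltNy0)// integral_ge0// => w _.
    by rewrite lee_fin sqr_ge0.
  (* If phi(V) - Y were in L2, so would be its difference with b, which is a. *)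
  apply/eqP; rewrite -leye_eq leNgt; apply/negP => coo.
  have cL : (fun w => phi (V w) - Y w)%R \in Lfun P 2%:E.
    apply/Lfun2P; split=> //.
    apply: measurable_funB; first exact: measurableT_comp.
    by have /Lfun2P[] := YL.
  have /Lfun2P[_] := Lfun2B cL bL; under eq_integral => w _.
    rewrite (_ : _ - _ = a w)%R; last by rewrite /a /b; ring.
    over.
  by rewrite aoo.
have aL : a \in Lfun P 2%:E by apply/Lfun2P.
have iab := Lfun2_mulr aL bL.
transitivity
    (\int[P]_w ((a w ^+ 2)%:E + (b w ^+ 2)%:E + 2%:E * (a w * b w)%:E)).
  apply: eq_integral => w _; rewrite -EFinM -!EFinD /a /b.
  by congr (_%:E); ring.
have ia2 := Lfun2_integrable_sqr aL; have ib2 := Lfun2_integrable_sqr bL.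
rewrite integralD//; [|exact: integrableD|exact: integrableZl].
rewrite integralD// integralZl//.
have -> : \int[P]_w (a w * b w)%:E = 0; last by rewrite mule0 adde0.
have := @cond_expectation_orthogonal (fun t => g t - phi t)%R.
rewrite (_ : (fun w => _%:E) = (fun w => (a w * b w)%:E)).
  by apply=> //; exact: measurable_funB.
by apply/funext => w; rewrite /a /b; congr (_%:E); ring.
Qed.

End given.

Lemma cond_expectation_scale (V Y : T -> R) (g : R -> R) (a : R) :
  measurable_fun setT V -> P.-integrable setT (EFin \o Y) ->
  is_cond_expectation P Y V g ->
  is_cond_expectation P (fun w => a * Y w)%R V (fun t => a * g t)%R.
Proof.
move=> mV iY [mg ig gB]; split.
- exact: measurable_funM.
- rewrite (_ : _ \o _ = (fun w => a%:E * (EFin \o (g \o V)) w)).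
    exact: integrableZl.
  by apply/funext => w /=; rewrite EFinM.
- move=> B mB; have mVB := measurable_preimage mV mB.
  under eq_integral do rewrite EFinM.
  under [RHS]eq_integral do rewrite EFinM.
  rewrite !integralZl//; try exact: (integrableS measurableT).
  by rewrite gB.
Qed.

(** The image under [V] of the charge with density [Y] is absolutely continuous
with respect to the law of [V]; its Radon-Nikodym derivative, a function on the
real line, is the conditional expectation. *)
Lemma cond_expectation_exists (V : {RV P >-> R}) (Y : T -> R) :
  P.-integrable setT (EFin \o Y) -> exists g, is_cond_expectation P Y V g.
Proof.
move=> iY; have mV : measurable_fun setT V by [].
have [nu nuE] : exists nu : {charge set R -> \bar R},
    forall B, nu B = \int[P]_(w in V @^-1` B) (Y w)%:E.
  unshelve refine (ex_intro _
    (pushforward (induced_charge iY) V : {charge set R -> \bar R}) _).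
    exact: mV.
  by [].
have nu_dom : nu `<< distribution P V.
  apply/null_content_dominatesP => B mB.
  rewrite /distribution /pushforward => PB.
  have mVB := measurable_preimage mV mB.
  rewrite nuE; apply: null_set_integral => //.
  exact: measurable_funTS (measurable_int _ iY).
pose f := Radon_Nikodym nu (distribution P V).
have f_fin t : f t \is a fin_num by exact: Radon_Nikodym_fin_num.
have fi : (distribution P V).-integrable setT f.
  exact: Radon_Nikodym_integrable.
have mf : measurable_fun setT f by exact: measurable_int fi.
have ifV : P.-integrable setT (f \o V).
  apply/integrableP; split; first exact: measurableT_comp.
  have /integrableP[_] := fi.
  by rewrite ge0_integral_distribution//; exact: measurableT_comp.
exists (fine \o f); split.
- exact: measurableT_comp.
- rewrite (_ : _ \o _ = f \o V)//.
  by apply/funext => w /=; rewrite fineK.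
- move=> B mB; rewrite -nuE (Radon_Nikodym_integral nu_dom mB).
  rewrite -/f integral_pushforward//=.
    by apply: eq_integral => w _; rewrite fineK.
  by apply: integrableS ifV => //; exact: measurable_preimage.
Qed.

End conditioning.

(** * Independence *)

Section independence.
Set Implicit Arguments.
Unset Strict Implicit.
Context (d : measure_display) (T : measurableType d) (R : realType).
Variable (P : probability T R).
Local Open Scope ereal_scope.

(** Both sides are finite measures in [A]: the restriction of [P] to [E] and a
multiple of [P].  Finite measures agreeing on a pi-system agree on the
sigma-algebra that it generates. *)
Lemma pi_system_indep (G : set_system T) (E : set T) :
  setI_closed G -> G setT -> G `<=` measurable -> measurable E ->
  (forall A, G A -> P (A `&` E) = P A * P E) ->
  forall A, <<s G >> A -> P (A `&` E) = P A * P E.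
Proof.
move=> GI GT mG mE GE A sA.
pose k := NngNum (fine_ge0 (measure_ge0 P E)).
have kE B : mscale k P B = P B * P E.
  by rewrite /mscale/= fineK ?fin_num_measure// muleC.
rewrite -kE; have := @g_sigma_algebra_measure_unique _ _ _ G mG (fun=> setT)
   (fun=> GT) _ (mrestr P mE) (mscale k P) GI; apply => //.
- by rewrite bigcup_const//; exists 0%N.
- by move=> B GB; exact: etrans (GE _ GB) (esym (kE B)).
- by move=> _; rewrite /= /mrestr setTI ltey_eq fin_num_measure.
Qed.

(** Independence says that the variable 1_A - P(A) integrates to 0 on all events
of sigma(X), so it is orthogonal to every function of [X], in particular to [X]
itself. *)
Lemma integral_indep_event (X : T -> R) (A : set T) :
  measurable_fun setT X -> measurable A -> P.-integrable setT (EFin \o X) ->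
  (forall B, measurable B -> P (A `&` X @^-1` B) = P A * P (X @^-1` B)) ->
  \int[P]_(w in A) (X w)%:E = P A * \int[P]_w (X w)%:E.
Proof.
move=> mX mA iX AX.
pose D w := (\1_A w - fine (P A))%R.
have mXB B : measurable B -> measurable (X @^-1` B).
  exact: measurable_preimage.
have PAE : (fine (P A))%:E = P A by rewrite fineK// fin_num_measure.
have iA B : measurable B -> P.-integrable B (EFin \o \1_A).
  by move=> mB; apply: integrableS (integrable_indic P mA).
have ic B : measurable B -> P.-integrable B (EFin \o cst (fine (P A))).
  by move=> mB; exact: finite_measure_integrable_cst.
have iD : P.-integrable setT (EFin \o D).
  rewrite (_ : _ \o _ = (EFin \o \1_A) \- (EFin \o cst (fine (P A)))).
    by apply: integrableB => //; [exact: iA|exact: ic].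
  by apply/funext => w /=; rewrite EFinB.
have iXA : P.-integrable setT (fun w => (X w * \1_A w)%:E).
  apply: (le_integrable measurableT _ _ iX).
    by apply/measurable_EFinP/measurable_funM.
  move=> w _; rewrite lee_fin normrM ler_piMr//.
  by rewrite indicE; case: (_ \in _); rewrite ?normr1 ?normr0.
have iXc : P.-integrable setT (fun w => (fine (P A))%:E * (X w)%:E).
  exact: integrableZl.
have XDE : (fun w => (X w * D w)%:E) =
    (fun w => (X w * \1_A w)%:E - (fine (P A))%:E * (X w)%:E).
  by apply/funext => w; rewrite /D mulrBr EFinB -EFinM [(fine _ * _)%R]mulrC.
have : \int[P]_w (X w * D w)%:E = 0.
  apply: (@integral_mul_comp_eq0 _ _ _ P D X id) => //.
    move=> B mB; under eq_integral do rewrite EFinB.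
    rewrite (integralB_EFin (mXB _ mB) (iA _ (mXB _ mB)) (ic _ (mXB _ mB))).
    rewrite integral_indic//; last exact: mXB.
    rewrite (integral_cst _ (mXB _ mB) (fine (P A))%:E).
    rewrite [X in X - _](AX B mB) PAE subee// fin_numM// fin_num_measure//.
    exact: mXB.
  by rewrite XDE; exact: integrableB.
rewrite XDE integralB// integralZl// PAE => /eqP.
rewrite sube_eq; last 2 first.
- exact: (integrable_fin_num measurableT iXA).
- by rewrite fin_num_adde_defr.
rewrite add0e => /eqP <-.
rewrite [LHS]integral_mkcond; apply: eq_integral => w _.
by rewrite patchE indicE; case: ifPn => _; rewrite ?mulr1 ?mulr0.
Qed.

Lemma mutually_independent_pair (X : nat -> {RV P >-> R}) i k A B :
  mutually_independent X -> i != k -> measurable A -> measurable B ->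
  P (X i @^-1` A `&` X k @^-1` B) = P (X i @^-1` A) * P (X k @^-1` B).
Proof.
move=> indep ik mA mB.
have := indep [:: i; k] (fun j => if j == i then A else B).
rewrite /= inE ik/= !big_cons big_nil eqxx eq_sym (negbTE ik) mule1.
move=> <-//; last by move=> j; case: ifP.
congr (P _); apply/seteqP; split => [w /= [wA wB] j /=|w /= h].
  by rewrite !inE => /orP[/eqP ->|/eqP ->]; rewrite ?eqxx// eq_sym (negbTE ik).
split; first by have := h i; rewrite /= inE eqxx; apply.
by have := h k; rewrite /= !inE eqxx orbT eq_sym (negbTE ik); apply.
Qed.

Lemma sigma_family_preimage (X : nat -> {RV P >-> R}) i A :
  measurable A -> sigma_family X (X i @^-1` A).
Proof.
move=> mA; apply: sub_sigma_algebra; exists i => //.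
by exists A; rewrite ?setTI.
Qed.

Lemma sigma_familyI (X : nat -> {RV P >-> R}) A B :
  sigma_family X A -> sigma_family X B -> sigma_family X (A `&` B).
Proof. exact: (@measurableI _ (g_sigma_algebraType _)). Qed.

Variables (x z v : nat -> {RV P >-> R}).
Hypothesis x_indep : mutually_independent x.
Hypothesis zx_indep : independent_families z x.
Hypothesis v_def : forall i w, v i w = (x i w + z i w)%R.
Hypothesis x_mean : forall i, 'E_P[x i] = 0.
Hypothesis x_int : forall i, P.-integrable setT (EFin \o x i).

(** The observation v_i = x_i + z_i is measurable for the sigma-algebra generated
by the pi-system of rectangles in (x_i, z_i).  On a rectangle, the independence of
the two families separates z_i from (x_i, x_k), and the independence of the
states separates x_i from x_k. *)
Lemma observation_indep i k A B : i != k -> measurable A -> measurable B ->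
  P (v i @^-1` A `&` x k @^-1` B) = P (v i @^-1` A) * P (x k @^-1` B).
Proof.
move=> ik mA mB.
have mX (X : {RV P >-> R}) C : measurable C -> measurable (X @^-1` C).
  exact: measurable_preimage.
pose G : set_system T := [set E | exists A1 A2,
  [/\ measurable A1, measurable A2 & E = x i @^-1` A1 `&` z i @^-1` A2]].
apply: (@pi_system_indep G).
- move=> _ _ [A1 [A2 [mA1 mA2 ->]]] [B1 [B2 [mB1 mB2 ->]]].
  exists (A1 `&` B1), (A2 `&` B2); split; [exact: measurableI..|].
  by rewrite !preimage_setI setIACA.
- by exists setT, setT; split=> //; rewrite !preimage_setT setTI.
- by move=> _ [A1 [A2 [mA1 mA2 ->]]]; apply: measurableI; exact: mX.
- exact: mX.
- move=> _ [A1 [A2 [mA1 mA2 ->]]].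
  rewrite setIAC setIC zx_indep; last 2 first.
  + exact: sigma_family_preimage.
  + by apply: sigma_familyI; exact: sigma_family_preimage.
  rewrite mutually_independent_pair// muleA; congr (_ * _).
  rewrite -zx_indep; last 2 first.
  + exact: sigma_family_preimage.
  + exact: sigma_family_preimage.
  by rewrite setIC.
- have sx : measurable_fun [set: g_sigma_algebraType G] (x i : T -> R).
    move=> _ C mC; rewrite setTI; apply: sub_sigma_algebra.
    by exists C, setT; rewrite preimage_setT setIT.
  have sz : measurable_fun [set: g_sigma_algebraType G] (z i : T -> R).
    move=> _ C mC; rewrite setTI; apply: sub_sigma_algebra.
    by exists setT, C; rewrite preimage_setT setTI.
  have sv : measurable_fun [set: g_sigma_algebraType G] (v i : T -> R).
    rewrite (_ : (v i : T -> R) = (x i : T -> R) \+ z i)%R.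
      exact: measurable_funD.
    by apply/funext => w; rewrite v_def.
  by have := sv measurableT A mA; rewrite setTI.
Qed.

Lemma integral_other_state i k B : i != k -> measurable B ->
  \int[P]_(w in v i @^-1` B) (x k w)%:E = 0.
Proof.
move=> ik mB; rewrite integral_indep_event//.
- by have := x_mean k; rewrite unlock => ->; rewrite mule0.
- exact: measurable_preimage.
- by move=> C mC; exact: observation_indep.
Qed.

(** Agent [i] tracks x_i plus the mean state.  Given v_i, the other states
contribute their zero mean, and x_i enters the mean state with weight 1/N. *)
Lemma cond_expectation_target N (i : 'I_N) (g : R -> R) :
  is_cond_expectation P (x i) (v i) g ->
  is_cond_expectation P (fun w => x i w + mean_state x N w)%R (v i)
    (fun t => (1 + N%:R^-1) * g t)%R.
Proof.
move=> gE; have [mg ig gB] := cond_expectation_scale (1 + N%:R^-1)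
  (measurable_funP (v i)) (x_int i) gE.
split=> // B mB; rewrite gB//.
have mVB := measurable_preimage (measurable_funP (v i)) mB.
have ix k : P.-integrable (v i @^-1` B) (EFin \o x k).
  exact: integrableS (x_int k).
have isum : P.-integrable (v i @^-1` B) (fun w => \sum_(k < N) (x k w)%:E).
  by apply: integrable_sum => // k _; exact: ix.
under eq_integral do rewrite EFinM.
rewrite integralZl//; last exact: ix.
have fin_ix : \int[P]_(w in v i @^-1` B) (x i w)%:E \is a fin_num.
  by apply: integrable_fin_num => //; exact: ix.
under [RHS]eq_integral do rewrite EFinD /mean_state EFinM -sumEFin.
rewrite integralD//; [|exact: ix|exact: integrableZl].
rewrite integralZl// integral_sum//; last by move=> k; exact: ix.
rewrite (bigD1 i)//= big1 ?adde0; last first.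
  by move=> k ki; rewrite integral_other_state// eq_sym.
by rewrite EFinD muleDl ?fin_num_adde_defr// mul1e.
Qed.

End independence.

(** * Teams of finite size *)

Section finite_team.
Set Implicit Arguments.
Unset Strict Implicit.
Context (d : measure_display) (T : measurableType d) (R : realType).
Variable (P : probability T R).
Local Open Scope ereal_scope.

(** With c = q / (r + q), completing the square gives
r u^2 + q (u - Y)^2 = (r + q) (u - c Y)^2 + r c Y^2; the Pythagorean identity
for c Y then isolates the only part that depends on the action.  [K] is chosen
before [phi], which makes costs of different actions comparable, including
infinite ones. *)
Lemma agent_cost (r q : R) (V Y : T -> R) (g : R -> R) :
  (0 < r)%R -> (0 <= q)%R -> measurable_fun setT V -> Y \in Lfun P 2%:E ->
  is_cond_expectation P Y V g ->
  exists K : R, forall phi : R -> R, measurable_fun setT phi ->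
    \int[P]_w (r * phi (V w) ^+ 2 + q * (phi (V w) - Y w) ^+ 2)%:E =
    (r + q)%:E * \int[P]_w ((phi (V w) - (r + q)^-1 * q * g (V w)) ^+ 2)%:E
    + K%:E.
Proof.
move=> r0 q0 mV YL gE; have rq0 : (0 < r + q)%R by rewrite ltr_pwDl.
pose c := ((r + q)^-1 * q)%R.
have cgE := cond_expectation_scale c mV (Lfun2_integrable YL) gE.
have cYL := Lfun2Z c YL.
have mY : measurable_fun setT Y by have /Lfun2P[] := YL.
have fY := Lfun2_integral_sqr_fin_num YL.
have cgL := cond_expectation_Lfun2 mV cYL cgE.
have fcY := Lfun2_integral_sqr_fin_num (Lfun2B cgL cYL).
exists ((r + q) * fine (\int[P]_w ((c * g (V w) - c * Y w) ^+ 2)%:E)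
  + r * c * fine (\int[P]_w (Y w ^+ 2)%:E))%R => phi mphi.
have mphiV : measurable_fun setT (phi \o V) by exact: measurableT_comp.
transitivity (\int[P]_w ((r + q)%:E * ((phi (V w) - c * Y w) ^+ 2)%:E +
    (r * c)%:E * (Y w ^+ 2)%:E)).
  apply: eq_integral => w _; rewrite -!EFinM -EFinD; congr (_%:E).
  by rewrite /c; field; rewrite gt_eqF.
have c0 : (0 <= c)%R by rewrite mulr_ge0// invr_ge0 ltW.
have rc0 : (0 <= r * c)%R by rewrite mulr_ge0// ltW.
have m1 : measurable_fun setT (fun w => ((phi (V w) - c * Y w) ^+ 2)%:E).
  apply/measurable_EFinP/measurable_funX/measurable_funB => //.
  exact: measurable_funM.
have m2 : measurable_fun setT (fun w => (Y w ^+ 2)%:E).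
  by apply/measurable_EFinP/measurable_funX.
rewrite ge0_integralD//; last 4 first.
- by move=> w _; rewrite mule_ge0// lee_fin ?sqr_ge0// ltW.
- exact: measurable_funeM.
- by move=> w _; rewrite mule_ge0// lee_fin sqr_ge0.
- exact: measurable_funeM.
rewrite !ge0_integralZl_EFin//; last 3 first.
- by move=> w _; rewrite lee_fin sqr_ge0.
- by move=> w _; rewrite lee_fin sqr_ge0.
- exact: ltW.
rewrite (cond_expectation_pythagoras mV cYL cgE mphi).
rewrite muleDr//; last by rewrite fin_num_adde_defl.
rewrite -addeA; congr (_ + _).
by rewrite [RHS]EFinD (EFinM (r + q)) (EFinM (r * c)) !fineK.
Qed.

Variables (x v : nat -> {RV P >-> R}) (r q : R).
Hypothesis r_gt0 : (0 < r)%R.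
Hypothesis q_ge0 : (0 <= q)%R.
Hypothesis x_L2 : forall i, (x i : T -> R) \in Lfun P 2%:E.
Variable g : nat -> R -> R.
Hypothesis gE : forall N (i : 'I_N),
  is_cond_expectation P (fun w => x i w + mean_state x N w)%R (v i)
    (fun t => (1 + N%:R^-1) * g i t)%R.

(** [g i] plays the role of a conditional expectation of x_i alone; the factor
1 + 1/N accounts for the mean state. *)
Definition team_gain (N : nat) : R := ((r + q)^-1 * q * (1 + N%:R^-1))%R.

(** The total squared distance to the optimal actions; by [team_cost] it is, up
to a positive factor when N > 0, the excess of the cost over its minimum. *)
Definition policy_gap N (gam : 'I_N -> R -> R) : \bar R :=
  \sum_(i < N) \int[P]_w ((gam i (v i w) - team_gain N * g i (v i w)) ^+ 2)%:E.

Lemma policy_gap_ge0 N (gam : 'I_N -> R -> R) : 0 <= policy_gap gam.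
Proof.
by apply: sume_ge0 => i _; apply: integral_ge0 => w _; rewrite lee_fin sqr_ge0.
Qed.

Lemma mean_state_Lfun2 N : mean_state x N \in Lfun P 2%:E.
Proof. by apply: Lfun2Z; apply: Lfun2_sum => k; exact: x_L2. Qed.

Lemma team_cost N : exists K : R, forall gam : 'I_N -> R -> R, policies gam ->
  cost_N x v r q gam = (N%:R^-1 * (r + q))%:E * policy_gap gam + K%:E.
Proof.
have rq0 : (0 <= r + q)%R by rewrite addr_ge0// ltW.
have YL (i : 'I_N) : (fun w => x i w + mean_state x N w)%R \in Lfun P 2%:E.
  exact: Lfun2D (x_L2 i) (mean_state_Lfun2 N).
have [K KE] := choice (fun i : 'I_N =>
  agent_cost r_gt0 q_ge0 (measurable_funP (v i)) (YL i) (gE i)).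
exists (N%:R^-1 * \sum_(i < N) K i)%R => gam mgam.
have mv (i : 'I_N) : measurable_fun setT (fun w => gam i (v i w)).
  by apply: measurableT_comp => //; exact: mgam.
rewrite /cost_N unlock.
under eq_integral do rewrite -sumEFin.
rewrite ge0_integral_sum//; last 2 first.
- move=> i; apply/measurable_EFinP.
  apply: measurable_funD; apply: measurable_funM => //.
    exact: measurable_funX.
  apply/measurable_funX/measurable_funB; first exact: measurable_funB.
  by have /Lfun2P[] := mean_state_Lfun2 N.
- by move=> i w _; rewrite lee_fin addr_ge0// mulr_ge0 ?sqr_ge0// ltW.
rewrite EFinM -muleA [(\sum_(i < N) K i)%R]/=.
have -> : \sum_(i < N) \int[P]_w (r * gam i (v i w) ^+ 2
         + q * (gam i (v i w) - x i w - mean_state x N w) ^+ 2)%:E =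
   (r + q)%:E * policy_gap gam + (\sum_(i < N) K i)%:E.
  rewrite /policy_gap ge0_sume_distrr; last first.
    by move=> i _; apply: integral_ge0 => w _; rewrite lee_fin sqr_ge0.
  rewrite -sumEFin -big_split/=; apply: eq_bigr => i _.
  have := KE i (gam i) (mgam i).
  under eq_integral do rewrite opprD addrA.
  under [in X in _ = X -> _]eq_integral do rewrite mulrA -/(team_gain N).
  by [].
by rewrite muleDr// -?EFinM// fin_num_adde_defl.
Qed.

Definition team_policy N (i : 'I_N) (t : R) : R := (team_gain N * g i t)%R.

Hypothesis mg : forall i, measurable_fun setT (g i).

Lemma team_policy_policies N : policies (@team_policy N).
Proof. by move=> i; exact: measurable_funM. Qed.

Lemma policy_gap_team_policy N : policy_gap (@team_policy N) = 0.
Proof.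
apply: big1 => i _; rewrite /team_policy.
under eq_integral do rewrite subrr expr0n/=.
exact: integral0.
Qed.

Lemma cost_N_team_policy_le N (gam : 'I_N -> R -> R) : policies gam ->
  cost_N x v r q (@team_policy N) <= cost_N x v r q gam.
Proof.
move=> mgam; have [K KE] := team_cost N.
rewrite (KE _ (@team_policy_policies N)) KE// policy_gap_team_policy mule0.
rewrite leeD2r// mule_ge0 ?policy_gap_ge0// lee_fin mulr_ge0 ?invr_ge0//.
by rewrite addr_ge0// ltW.
Qed.

Lemma optimal_N_team_policy N : optimal_N x v r q (@team_policy N).
Proof.
split; first exact: team_policy_policies.
apply/eqP; rewrite eq_le; apply/andP; split.
  by apply: le_ereal_inf_tmp => _ [gam mgam <-]; exact: cost_N_team_policy_le.
apply: ereal_inf_lbound; exists (@team_policy N) => //.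
exact: team_policy_policies.
Qed.

(** An optimal policy has the same finite cost as [team_policy], hence gap 0, and
all the terms of a vanishing sum of nonnegative integrals vanish. *)
Lemma optimal_N_unique N (gam : 'I_N -> R -> R) : (0 < N)%N ->
  optimal_N x v r q gam ->
  forall i, {ae P, forall w, gam i (v i w) = team_policy i (v i w)}.
Proof.
move=> N0 [mgam gam_opt] i.
have [_ star_opt] := optimal_N_team_policy N.
have [K KE] := team_cost N.
have gap0 : policy_gap gam = 0.
  move: gam_opt; rewrite -star_opt KE// (KE _ (@team_policy_policies N)).
  rewrite policy_gap_team_policy mule0 => /eqP.
  rewrite add0e => /eqP /(congr1 (fun t => t - K%:E)).
  rewrite addeK// subee// => /eqP.
  rewrite mule_eq0 eqe gt_eqF/=; first by move/eqP.
  by rewrite mulr_gt0 ?invr_gt0 ?ltr0n// ltr_pwDl.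
have sq_ge0 (j : 'I_N) : true ->
    0 <= \int[P]_w ((gam j (v j w) - team_gain N * g j (v j w)) ^+ 2)%:E.
  by move=> _; apply: integral_ge0 => w _; rewrite lee_fin sqr_ge0.
have /eqP := gap0; rewrite /policy_gap seq_psume_eq0// => /allP/(_ i).
rewrite mem_index_enum/= => /(_ isT)/eqP i0.
have mi : measurable_fun setT
    (fun w => ((gam i (v i w) - team_gain N * g i (v i w)) ^+ 2)%:E).
  apply/measurable_EFinP/measurable_funX/measurable_funB.
    by apply: measurableT_comp => //; exact: mgam.
  by apply: measurable_funM => //; exact: measurableT_comp.
have /(ae_eq_integral_abs P measurableT mi) :
    \int[P]_w `|((gam i (v i w) - team_gain N * g i (v i w)) ^+ 2)%:E| = 0.
  by under eq_integral do rewrite gee0_abs ?lee_fin ?sqr_ge0//.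
apply: filterS => w /(_ I) /eqP.
by rewrite eqe sqrf_eq0 subr_eq0 => /eqP.
Qed.

End finite_team.

(** * The infinite team *)

Section infinite_team.
Set Implicit Arguments.
Unset Strict Implicit.
Context (d : measure_display) (T : measurableType d) (R : realType).
Variable (P : probability T R).
Local Open Scope ereal_scope.

Variables (x v : nat -> {RV P >-> R}) (r q : R).
Hypothesis r_gt0 : (0 < r)%R.
Hypothesis q_ge0 : (0 <= q)%R.
Hypothesis x_dist : identically_distributed x.
Hypothesis x_L2 : forall i, (x i : T -> R) \in Lfun P 2%:E.
Variable g : nat -> R -> R.
Hypothesis gE : forall k, is_cond_expectation P (x k) (v k) (g k).
Hypothesis gE_N : forall N (i : 'I_N),
  is_cond_expectation P (fun w => x i w + mean_state x N w)%R (v i)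
    (fun t => (1 + N%:R^-1) * g i t)%R.

Let mg k : measurable_fun setT (g k). Proof. by have [] := gE k. Qed.

Definition limit_policy (k : nat) (t : R) : R := ((r + q)^-1 * q * g k t)%R.

Lemma limit_policy_policies : policies limit_policy.
Proof. by move=> k; exact: measurable_funM. Qed.

(** The limit policy is off by the gain c/N, and the N second moments of the
conditional expectations are bounded by the common second moment of the states.
The factors N and 1/N^2 are kept apart so that N = 0 is covered. *)
Lemma policy_gap_limit_policy : exists S : R, forall N,
  policy_gap v r q g (fun i : 'I_N => limit_policy i) <=
  (N%:R * (N%:R^-1 ^+ 2 * S))%:E.
Proof.
pose c := ((r + q)^-1 * q)%R.
pose S := fine (\int[P]_w (x 0%N w ^+ 2)%:E).
have SE : S%:E = \int[P]_w (x 0%N w ^+ 2)%:E.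
  by rewrite fineK//; exact: Lfun2_integral_sqr_fin_num.
exists (c ^+ 2 * S)%R => N.
rewrite -[X in (X%:R * _)%R]card_ord mulr_natl -sumr_const -sumEFin.
apply: lee_sum => i _.
under eq_integral => w _.
  rewrite (_ : (_ - _) ^+ 2 = (N%:R^-1 * c) ^+ 2 * g i (v i w) ^+ 2)%R;
    last by rewrite /limit_policy /team_gain /c; ring.
  rewrite EFinM.
  over.
rewrite ge0_integralZl_EFin//; last 3 first.
- by move=> w _; rewrite lee_fin sqr_ge0.
- by apply/measurable_EFinP/measurable_funX; exact: measurableT_comp.
- exact: sqr_ge0.
rewrite mulrA -exprMn [leRHS]EFinM lee_wpmul2l ?lee_fin ?sqr_ge0//.
rewrite SE -(identically_distributed_sqr i 0 x_dist).
exact: cond_expectation_sqr_le (measurable_funP (v i)) (x_L2 i) (gE i).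
Qed.

(** The excess cost of the limit policy is at most (r + q) S / N^2, which is at
most [e] as soon as N >= 1 and N >= (r + q) S / e. *)
Lemma limit_policy_near_optimal (e : R) : (0 < e)%R -> \forall N \near \oo,
  forall gam : 'I_N -> R -> R, policies gam ->
  cost_N x v r q (fun i : 'I_N => limit_policy i) <= cost_N x v r q gam + e%:E.
Proof.
move=> e0; have [S gapS] := policy_gap_limit_policy.
have rq0 : (0 < r + q)%R by rewrite ltr_pwDl.
near=> N => gam mgam.
have N1 : (1 <= N%:R :> R)%R by near: N; exact: nbhs_infty_ger.
have NC : ((r + q) * S / e <= N%:R)%R by near: N; exact: nbhs_infty_ger.
have [K KE] := team_cost r_gt0 q_ge0 x_L2 gE_N N.
have coef0 : (0 <= N%:R^-1 * (r + q))%R by rewrite mulr_ge0 ?invr_ge0// ltW.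
rewrite !KE//; last by move=> i; exact: limit_policy_policies.
rewrite addeAC leeD2r//.
apply: (@le_trans _ _ e%:E); last first.
  by rewrite leeDr// mule_ge0// policy_gap_ge0.
have coefE : 0 <= (N%:R^-1 * (r + q))%:E by rewrite lee_fin.
apply: (le_trans (lee_wpmul2l coefE (gapS N))).
rewrite -EFinM lee_fin.
have N0 : (0 < N%:R :> R)%R by exact: lt_le_trans ltr01 N1.
have -> : (N%:R^-1 * (r + q) * (N%:R * (N%:R^-1 ^+ 2 * S)) =
   (r + q) * S / N%:R / N%:R)%R by field; rewrite gt_eqF.
rewrite ler_pdivrMr// (@le_trans _ _ e)//; last by rewrite ler_peMr// ltW.
by rewrite ler_pdivrMr// [leRHS]mulrC -ler_pdivrMr.
Unshelve. all: by end_near. Qed.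

Lemma limit_policy_globally_optimal : globally_optimal x v r q limit_policy.
Proof.
split; first exact: limit_policy_policies.
apply/eqP; rewrite eq_le; apply/andP; split; last first.
  apply: ereal_inf_lbound; exists limit_policy => //.
  exact: limit_policy_policies.
apply: le_ereal_inf_tmp => _ [gam mgam <-].
apply: le_limn_esup_near => e e0.
apply: filterS (limit_policy_near_optimal e0) => N; apply.
by move=> i; exact: mgam.
Qed.

Lemma team_gain_cvg k :
  team_gain r q (k.+1 + n) @[n --> \oo] --> ((r + q)^-1 * q)%R.
Proof.
rewrite -[X in _ --> X]mulr1; apply: cvgM; first exact: cvg_cst.
rewrite -[X in _ --> X]addr0; apply: cvgD; first exact: cvg_cst.
(* harmonic n is 1/(n + 1); the team sizes k + 1 + n are a shift of n + 1. *)
have := @cvg_harmonic R; rewrite -(cvg_shiftn k).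
rewrite (_ : [sequence _]_n = fun n => ((k.+1 + n)%N%:R^-1)%R)//.
by apply/funext => n; rewrite /harmonic/= addSn addnC.
Qed.

(** Each optimal policy is determined outside a null set that depends on the
team size; countably many such sets are discarded together. *)
Lemma agent_policies_cvg (gamN : forall N, 'I_N -> R -> R) k :
  (forall N, (0 < N)%N -> optimal_N x v r q (gamN N)) ->
  {ae P, forall w, agent_policies k gamN n (v k w) @[n --> \oo] -->
    limit_policy k (v k w)}.
Proof.
move=> gamN_opt.
have : {ae P, forall w n, agent_policies k gamN n (v k w) =
    (team_gain r q (k.+1 + n) * g k (v k w))%R}.
  apply/ae_foralln => n.
  have gamN_opt_n := gamN_opt (k.+1 + n)%N isT.
  exact: (optimal_N_unique r_gt0 q_ge0 x_L2 gE_N mg _ gamN_opt_n).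
apply: filterS => w wE; under eq_fun do rewrite wE.
apply: cvgM; [exact: team_gain_cvg|exact: cvg_cst].
Qed.

End infinite_team.

Theorem theorem14 (d : measure_display) (T : measurableType d) (R : realType)
    (P : probability T R) (x z v : nat -> {RV P >-> R}) (r q : R)
    (x_iid : iid x) (z_iid : iid z)
    (x_mean : forall i, ('E_P[x i] = 0)%E) (z_mean : forall i, ('E_P[z i] = 0)%E)
    (x_var : forall i, ('V_P[x i] < +oo)%E)
    (z_var : forall i, ('V_P[z i] < +oo)%E)
    (zx_indep : independent_families z x)
    (v_def : forall i w, v i w = x i w + z i w)
    (r_gt0 : 0 < r) (q_ge0 : 0 <= q) :
  (forall k, exists g : R -> R, is_cond_expectation P (x k) (v k) g) /\
  (forall N, (0 < N)%N ->
     exists gam : 'I_N -> R -> R, optimal_N x v r q gam) /\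
  forall g : nat -> R -> R,
    (forall k, is_cond_expectation P (x k) (v k) (g k)) ->
    globally_optimal x v r q (fun k t => (r + q)^-1 * q * g k t) /\
    forall gamN : (forall N : nat, 'I_N -> R -> R),
      (forall N, (0 < N)%N -> optimal_N x v r q (gamN N)) ->
      forall k, {ae P, forall w,
        agent_policies k gamN n (v k w) @[n --> \oo] -->
          (r + q)^-1 * q * g k (v k w)}.
Proof.
have x_L2 i : (x i : T -> R) \in Lfun P 2%:E by exact: centered_Lfun2.
have x_int i := Lfun2_integrable (x_L2 i).
have ex_g k : exists g : R -> R, is_cond_expectation P (x k) (v k) g.
  exact: cond_expectation_exists.
have target g : (forall k, is_cond_expectation P (x k) (v k) (g k)) ->
    forall N (i : 'I_N),
    is_cond_expectation P (fun w => x i w + mean_state x N w) (v i)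
      (fun t => (1 + N%:R^-1) * g i t).
  move=> gE N i.
  exact: (cond_expectation_target x_iid.1 zx_indep v_def x_mean x_int (gE i)).
split; first exact: ex_g.
split.
  move=> N _; have [g gE] := choice ex_g.
  exists (@team_policy _ r q g N).
  apply: optimal_N_team_policy => //; first exact: target.
  by move=> i; have [] := gE i.
move=> g gE; split.
  exact: limit_policy_globally_optimal r_gt0 q_ge0 x_iid.2 x_L2 _ gE
    (target g gE).
move=> gamN gamN_opt k.
exact: agent_policies_cvg r_gt0 q_ge0 x_L2 _ gE (target g gE) _ k gamN_opt.
Qed.
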